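(* Let $n\ge2$, $\xi_n=\frac{n+1}{n-1}$, $\rho\in\mathbb{C}\setminus\{-\xi_n,-1,1,\xi_n\}$, and let $z_0,\dots,z_{2n-1}$ be the $2n$ zeros (with multiplicity) of $p_{2n}(\rho,z)$. Then $z_k\neq\pm1$ for all $k$. Furthermore each $z_k$ is of exactly one of the following two (mutually exclusive) types: Type 1: $s_{n+1}(\rho,z_k)=s_{n+1}(\rho,z_k^{-1})=0$; in this case $$\lambda_k=\frac{z_k^{1-n}(1-\rho^2)}{(z_k-\rho)^2}=\frac{z_k^{n+1}(1-\rho^2)}{(1-\rho z_k)^2}$$ is an eigenvalue (called a type-1 eigenvalue) of $K_n(\rho)$. Type 2: $c_{n+1}(\rho,z_k)=c_{n+1}(\rho,z_k^{-1})=0$; in this case $$\lambda_k=-\frac{z_k^{1-n}(1-\rho^2)}{(z_k-\rho)^2}=-\frac{z_k^{n+1}(1-\rho^2)}{(1-\rho z_k)^2}$$ is an eigenvalue (called a type-2 eigenvalue) of $K_n(\rho)$. There are $2\lfloor n/2\rfloor$ type-1 zeros and $2\lceil n/2\rceil$ type-2 zeros, corresponding (each inverse pair $\{z_k,z_k^{-1}\}$ giving one eigenvalue) to $\lfloor n/2\rfloor$ type-1 eigenvalues and $\lceil n/2\rceil$ type-2 eigenvalues.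
   Context: $K_n(\rho)=\left[\rho^{|j-k|}\right]_{j,k=1}^n$ (with $\rho^0=1$). $p_{2n}(\rho,z)=z^{2n}+(1+\rho^2)\sum_{k=1}^{n-1}z^{2k}-2\rho\sum_{k=0}^{n-1}z^{2k+1}+1$; $s_{n+1}(\rho,z)=z^{n+1}-\rho z^n+\rho z-1$; $c_{n+1}(\rho,z)=z^{n+1}-\rho z^n-\rho z+1$; for $z\neq\pm1$, $p_{2n}(\rho,z)=\frac{s_{n+1}(\rho,z)c_{n+1}(\rho,z)}{z^2-1}$. Zeros are counted with multiplicity. *)

(* Defs.v *)
(* The complex field is modelled by an arbitrary
   numClosedFieldType C (algebraically closed, characteristic 0; C = complex
   numbers is an instance). *)
From mathcomp Require Import all_boot all_order all_algebra.
Set Implicit Arguments. Unset Strict Implicit. Unset Printing Implicit Defensive.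
Import Order.TTheory GRing.Theory Num.Theory.
Local Open Scope ring_scope.

Section Defs.
Variable C : numClosedFieldType.

Definition kms (n : nat) (rho : C) : 'M[C]_n :=
  \matrix_(j < n, k < n) rho ^+ (maxn j k - minn j k)%N.

Definition p2n (n : nat) (rho : C) : {poly C} :=
  'X^(2 * n) + (1 + rho ^+ 2) *: \sum_(1 <= k < n) 'X^(2 * k)
  - (2 * rho) *: \sum_(0 <= k < n) 'X^(2 * k + 1) + 1.

Definition sfun (m : nat) (rho z : C) : C :=
  z ^+ m - rho * z ^+ m.-1 + rho * z - 1.

Definition cfun (m : nat) (rho z : C) : C :=
  z ^+ m - rho * z ^+ m.-1 - rho * z + 1.

Definition xi (n : nat) : C := (n.+1)%:R / (n.-1)%:R.

Definition type1 (n : nat) (rho z : C) : bool :=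
  (sfun n.+1 rho z == 0) && (sfun n.+1 rho z^-1 == 0).
Definition type2 (n : nat) (rho z : C) : bool :=
  (cfun n.+1 rho z == 0) && (cfun n.+1 rho z^-1 == 0).

Definition lamA (n : nat) (rho z : C) : C :=
  z ^- (n.-1) * (1 - rho ^+ 2) / (z - rho) ^+ 2.
Definition lamB (n : nat) (rho z : C) : C :=
  z ^+ n.+1 * (1 - rho ^+ 2) / (1 - rho * z) ^+ 2.

End Defs.

(* Main.v *)
Require Import Defs.
From mathcomp Require Import all_boot all_order all_algebra.
From mathcomp Require Import ring zify.
Set Implicit Arguments. Unset Strict Implicit. Unset Printing Implicit Defensive.
Import Order.TTheory GRing.Theory Num.Theory.
Local Open Scope ring_scope.

(* A unit bidiagonal congruence turns [x I - K_n(rho)] into a tridiagonal matrix,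
   whose determinant satisfies a three-term recurrence. Substituting
   [x = (1 - rho^2) w / ((w - rho) (1 - rho w))] solves the recurrence and gives
   [det (x I - K_n) = (x rho / w)^n p_{2n}(w) / (1 - rho^2)]. The polynomial
   [p_{2n}] is palindromic and does not vanish at [1] and [-1], so its zeros split
   into inverse pairs, and the characteristic polynomial is the product of
   [X - lambda(z)] over one [z] per pair. Finally [(z^2 - 1) p_{2n} = s_{n+1} c_{n+1}]
   where [s_{n+1}] and [c_{n+1}] have no common zero, which separates the two
   types; counting the zeros of [s_{n+1}] other than [1] and [-1] gives the numbers. *)

(** * Reduction of the determinant to a tridiagonal one and its closed form *)

(** Expansion along the last row leaves two terms. The minor of the off-diagonal one has a single
    nonzero entry in its last column, so a second expansion finishes. *)
Lemma det_tridiag_rec (R : comNzRingType) (f : nat -> nat -> R) (n : nat) :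
  (forall i j, (i.+1 < j)%N || (j.+1 < i)%N -> f i j = 0) ->
  \det (\matrix_(i < n.+2, j < n.+2) f i j) =
  f n.+1 n.+1 * \det (\matrix_(i < n.+1, j < n.+1) f i j)
  - f n.+1 n * f n n.+1 * \det (\matrix_(i < n, j < n) f i j).
Proof.
move=> f0.
rewrite (expand_det_row _ ord_max) big_ord_recr big_ord_recr /= big1 ?add0r; last first.
  by move=> i _; rewrite mxE f0 ?mul0r //= ; have := ltn_ord i; lia.
rewrite !mxE /= addrC; congr (_ + _).
  rewrite /cofactor /= addnn -signr_odd odd_double expr0 mul1r; congr (_ * \det _).
  by apply/matrixP=> i j; rewrite !mxE !lift_max.
rewrite -mulrA -mulrN; congr (_ * _).
rewrite /cofactor /= addSn exprS addnn -signr_odd odd_double expr0 mulr1 mulN1r.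
congr (- _).
rewrite (expand_det_col _ ord_max) big_ord_recr /= big1 ?add0r; last first.
  move=> i _; rewrite !mxE f0 ?mul0r //=.
  by have := ltn_ord i; rewrite /bump; lia.
rewrite !mxE /= /bump ltnn leqnn add0n add1n; congr (_ * _).
rewrite /cofactor /= addnn -signr_odd odd_double expr0 mul1r; congr (\det _).
apply/matrixP=> i j; rewrite !mxE !lift_max /= /bump /=.
have hi := ltn_ord i; have hj := ltn_ord j.
by rewrite [(n <= j)%N]leqNgt hj /= !add0n [(n <= j)%N]leqNgt hj.
Qed.

(* [x I - K_n] becomes tridiagonal once multiplied by the unit bidiagonal matrix
   [I - rho N] ([N] the subdiagonal shift) on the left and its transpose on the right. *)
Definition kms_tridiag (R : comNzRingType) (rho x : R) (i j : nat) : R :=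
  if i == j then
    if i == 0%N then x - 1 else x * (1 + rho ^+ 2) - (1 - rho ^+ 2)
  else if (i == j.+1) || (j == i.+1) then - (x * rho) else 0.

Definition bidiag (R : comNzRingType) (rho : R) (n : nat) : 'M[R]_n :=
  \matrix_(i < n, j < n) ((i == j)%:R - rho * (i == j.+1 :> nat)%:R).

Lemma det_bidiag (R : comNzRingType) (rho : R) (n : nat) :
  \det (bidiag rho n) = 1.
Proof.
rewrite det_trig; last first.
  apply/is_trig_mxP => i j ij; rewrite mxE.
  have -> : (i == j) = false by apply/eqP => e; rewrite e ltnn in ij.
  by have -> : (i == j.+1 :> nat) = false; [lia | rewrite mulr0 subr0].
rewrite big1 // => i _; rewrite mxE eqxx.
by have -> : (i == i.+1 :> nat) = false; [lia | rewrite mulr0 subr0].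
Qed.

Lemma mul_bidiag_mx (R : comNzRingType) (rho : R) (n m : nat)
    (f : nat -> 'I_m -> R) (i : 'I_n) (j : 'I_m) :
  (bidiag rho n *m \matrix_(i < n, j < m) f i j) i j =
  f i j - rho * (if i == 0%N :> nat then 0 else f i.-1 j).
Proof.
rewrite mxE.
under eq_bigr => k _ do rewrite !mxE mulrBl.
rewrite sumrB (bigD1 i) //= eqxx mul1r big1 ?addr0; last first.
  by move=> k ki; rewrite eq_sym (negPf ki) mul0r.
congr (_ - _).
have [i0|i0] := eqVneq (i : nat) 0%N.
  rewrite big1 ?mulr0 // => k _.
  by rewrite i0 mulr0 mul0r.
have lt_i : (i.-1 < n)%N by have := ltn_ord i; lia.
rewrite (bigD1 (Ordinal lt_i)) //= big1 ?addr0; last first.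
  move=> k ki; have -> : (i == k.+1 :> nat) = false; last by rewrite mulr0 mul0r.
  by apply: contraNF ki => /eqP e; apply/eqP/val_inj; rewrite /= e.
by have -> : (i == i.-1.+1 :> nat); [lia | rewrite mulr1].
Qed.

(** Toeplitz entries depend only on the distance of the indices; each one is replaced by its value
    at one of the few distances that occur. *)
Ltac normf hE d :=
  repeat match type of hE with forall e a b, _ -> ?f a b = _ =>
    match goal with |- context [f ?a ?b] =>
      first [ rewrite (hE 0%N a b); [|lia] | rewrite (hE 1%N a b); [|lia]
            | rewrite (hE 2%N a b); [|lia] | rewrite (hE d.+1 a b); [|lia]
            | rewrite (hE d.+2 a b); [|lia] | rewrite (hE d.+3 a b); [|lia]]
    end end.

(** Subtracting [rho] times the previous row, then column, cancels the geometric entries below, then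
    above, the diagonal. So [K_n] becomes diagonal, while [x I] becomes [x] times the tridiagonal
    product of [bidiag] and its transpose. *)
Lemma kms_congr_tridiag (C : numClosedFieldType) (rho x : C) (n : nat) :
  bidiag rho n *m (x%:M - kms n rho) *m (bidiag rho n)^T =
  \matrix_(i < n, j < n) kms_tridiag rho x i j.
Proof.
pose h (d : nat) : C := x * (d == 0%N)%:R - rho ^+ d.
pose f i j := h (maxn i j - minn i j)%N.
have hE (d a b : nat) : (a = b + d \/ b = a + d)%N -> f a b = h d.
  by rewrite /f => abd; congr h; lia.
have -> : x%:M - kms n rho = \matrix_(i < n, j < n) f i j.
  apply/matrixP=> i j; rewrite !mxE /f /h -[_ *+ _]mulr_natr.
  by rewrite -val_eqE /=; congr (_ * _%:R - _); lia.
pose g i j := f i j - rho * (if i == 0%N :> nat then 0 else f i.-1 j).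
have -> : bidiag rho n *m \matrix_(i < n, j < n) f i j = \matrix_(i < n, j < n) g i j.
  by apply/matrixP => i j; rewrite (mul_bidiag_mx _ (fun k (j : 'I_n) => f k j)) mxE.
(* Transposing turns the right multiplication into a left one, so [mul_bidiag_mx] applies again. *)
apply: trmx_inj; rewrite trmx_mul trmxK.
have -> : (\matrix_(i < n, j < n) g i j)^T = \matrix_(j < n, i < n) g i j.
  by apply/matrixP => i j; rewrite !mxE.
apply/matrixP => i j; rewrite (mul_bidiag_mx _ (fun k (j : 'I_n) => g j k)) !mxE /=.
move: (i : nat) (j : nat) => {}j {}i; rewrite /g /kms_tridiag.
have key (a b : nat) : (b < a)%N -> exists d, a = (b + d).+1.
  by move=> ba; exists (a - b).-1; lia.
have [/key[d ->]|/key[d ->]|->] := ltngtP i j; last first.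
- by case: j => [|j] /=; normf hE 0%N; rewrite /h ?eqxx /=; ring.
- have -> : (j == (j + d).+2) = false by lia.
  have -> : ((j + d).+1 == j.+1) = (d == 0%N) by lia.
  rewrite orbF.
  by case: j => [|j]; case: d => [|d] /=; first [normf hE d | normf hE 0%N];
    rewrite /h /= ?exprS; ring.
- have -> : (i == (i + d).+2) = false by lia.
  have -> : ((i + d).+1 == i.+1) = (d == 0%N) by lia.
  by case: i => [|i]; case: d => [|d] /=; first [normf hE d | normf hE 0%N];
    rewrite /h /= ?exprS; ring.
Qed.

Lemma det_scalar_sub_kms (C : numClosedFieldType) (rho x : C) (n : nat) :
  \det (x%:M - kms n rho) = \det (\matrix_(i < n, j < n) kms_tridiag rho x i j).
Proof.
by rewrite -kms_congr_tridiag !det_mulmx det_tr det_bidiag mul1r mulr1.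
Qed.

(* The last factor is [s_{n+1}(w) c_{n+1}(w)], so for [w^2 != 1] this says
   [det (x I - K_n) = (x rho / w)^n p_{2n}(w) / (1 - rho^2)]. *)
Lemma det_kms_closed_form (C : numClosedFieldType) (rho x w : C) (n : nat) :
  x * rho * (w ^+ 2 + 1) = (x * (1 + rho ^+ 2) - (1 - rho ^+ 2)) * w ->
  w ^+ n * ((w ^+ 2 - 1) * (1 - rho ^+ 2)) * \det (x%:M - kms n rho) =
  (x * rho) ^+ n * (w ^+ n.*2 * (w - rho) ^+ 2 - (1 - rho * w) ^+ 2).
Proof.
move=> xw; rewrite det_scalar_sub_kms.
pose D n := \det (\matrix_(i < n, j < n) kms_tridiag rho x i j).
rewrite -/(D n).
have rec k : D k.+2 =
    (x * (1 + rho ^+ 2) - (1 - rho ^+ 2)) * D k.+1 - (x * rho) ^+ 2 * D k.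
  rewrite /D det_tridiag_rec.
    rewrite /kms_tridiag eqxx /=.
    have [-> ->] : (k.+1 == k) = false /\ (k == k.+1) = false by lia.
    rewrite orbT.
    by rewrite mulrNN -expr2.
  move=> i j ij; rewrite /kms_tridiag.
  have -> : (i == j) = false by lia.
  by have -> : (i == j.+1) || (j == i.+1) = false by lia.
(* The recurrence has order two, so two consecutive cases are carried along. By [xw], its
   characteristic roots are [x rho w] and [x rho / w] when [w] is nonzero. *)
suff [] : (w ^+ n * ((w ^+ 2 - 1) * (1 - rho ^+ 2)) * D n =
  (x * rho) ^+ n * (w ^+ n.*2 * (w - rho) ^+ 2 - (1 - rho * w) ^+ 2)) /\
  (w ^+ n.+1 * ((w ^+ 2 - 1) * (1 - rho ^+ 2)) * D n.+1 =
  (x * rho) ^+ n.+1 * (w ^+ n.+1.*2 * (w - rho) ^+ 2 - (1 - rho * w) ^+ 2)) by [].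
elim: n => [|n [IH0 IH1]].
  rewrite /D det_mx00 det_mx11 mxE /kms_tridiag /=.
  split; first by ring.
  rewrite !expr1; transitivity ((w ^+ 2 - 1) * (x * rho * (w ^+ 2 + 1) - 2 * x * rho ^+ 2 * w)).
    by rewrite xw; ring.
  by rewrite [1.*2]/=; ring.
split=> //; rewrite rec mulrBr.
have -> : w ^+ n.+2 * ((w ^+ 2 - 1) * (1 - rho ^+ 2)) *
    ((x * (1 + rho ^+ 2) - (1 - rho ^+ 2)) * D n.+1) =
    (x * rho) * (w ^+ 2 + 1) * (w ^+ n.+1 * ((w ^+ 2 - 1) * (1 - rho ^+ 2)) * D n.+1).
  by rewrite xw !exprS; ring.
have -> : w ^+ n.+2 * ((w ^+ 2 - 1) * (1 - rho ^+ 2)) * ((x * rho) ^+ 2 * D n) =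
    (x * rho) ^+ 2 * w ^+ 2 * (w ^+ n * ((w ^+ 2 - 1) * (1 - rho ^+ 2)) * D n).
  by rewrite !exprS; ring.
rewrite IH0 IH1 !doubleS !exprS; ring.
Qed.

(** * Two general tools: polynomial identities by evaluation, and pairing by an involution *)

(** The product [(p - q) * r] vanishes everywhere, in particular at as many distinct naturals as its
    size, so it is zero. The role of [r] is to exclude finitely many bad points. *)
Lemma eq_poly_of_horner (R : numDomainType) (p q r : {poly R}) :
  r != 0 -> (forall x, r.[x] != 0 -> p.[x] = q.[x]) -> p = q.
Proof.
move=> r0 pq; apply/eqP; rewrite -subr_eq0.
have: (p - q) * r == 0.
  apply/negPn/negP=> h0.
  pose m := size ((p - q) * r).
  have := @max_poly_roots _ _ [seq i%:R | i <- iota 0 m] h0.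
  rewrite size_map size_iota ltnn => H; apply: notF; apply: H.
    apply/allP=> x _; rewrite rootE hornerM hornerD hornerN.
    by have [->|/pq ->] := eqVneq r.[x] 0; rewrite ?mulr0 // subrr mul0r.
  by rewrite map_inj_uniq ?iota_uniq //; exact: mulrIn (oner_neq0 _).
by rewrite mulf_eq0 (negPf r0) orbF.
Qed.

(** Induction on the size: [x] and [f x] are distinct members, and removing both leaves a multiset
    still invariant under [f]. *)
Lemma perm_involutive_split (T : eqType) (f : T -> T) (s : seq T) :
  involutive f -> (forall z, z \in s -> f z != z) -> perm_eq s (map f s) ->
  exists t, perm_eq s (t ++ map f t).
Proof.
move=> fK; have [m] := ubnP (size s); elim: m s => // m IH [|x s] //= lesm fx ps.
  by exists [::].
have fxs : f x \in s.
  have: f x \in x :: s by rewrite (perm_mem ps) in_cons eqxx.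
  by rewrite inE (negPf (fx x (mem_head _ _))).
have ps' := perm_to_rem fxs.
case: (IH (rem (f x) s)).
- by rewrite size_rem //; case: (s) lesm fxs => //= a l; lia.
- by move=> z /mem_rem zs; apply: fx; rewrite inE zs orbT.
- have: perm_eq (x :: f x :: rem (f x) s) (map f (x :: f x :: rem (f x) s)).
    have ps2 : perm_eq (x :: s) (x :: f x :: rem (f x) s) by rewrite perm_cons.
    rewrite -(permPl ps2) (permPl ps) -[_ :: _]/(map f (x :: s)).
    by apply: perm_map.
  rewrite /= fK (permPr (permEl (perm_catC [:: f x] (x :: _)))) /= perm_cons.
  by rewrite (permPr (permEl (perm_catC _ [:: f x]))) /= perm_cons.
move=> t pt; exists (x :: t) => /=; rewrite perm_cons (permPl ps').
rewrite (permPr (permEl (perm_catC t (f x :: _)))) /= perm_cons.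
by rewrite (permPl pt) perm_catC.
Qed.

(** * Values and symmetries of [p_{2n}], [s_{n+1}] and [c_{n+1}] *)

Section Zeros.
Variables (C : numClosedFieldType) (rho : C).
Implicit Types (n : nat) (z w : C).

(** With this grouping, and the opposite sign in [cfunE], the product of the two is the difference
    of squares found in [det_kms_closed_form]. *)
Lemma sfunE n z : sfun n.+1 rho z = z ^+ n * (z - rho) - (1 - rho * z).
Proof. by rewrite /sfun /= exprS; ring. Qed.

Lemma cfunE n z : cfun n.+1 rho z = z ^+ n * (z - rho) + (1 - rho * z).
Proof. by rewrite /cfun /= exprS; ring. Qed.

Lemma sfun_mul_cfun n z :
  sfun n.+1 rho z * cfun n.+1 rho z =
  z ^+ n.*2 * (z - rho) ^+ 2 - (1 - rho * z) ^+ 2.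
Proof. by rewrite sfunE cfunE -addnn exprD; ring. Qed.

(** A common zero has [rho z = 1] and [z^n (z - rho) = 0], hence [z = rho] and [rho^2 = 1]. *)
Lemma sfun_cfun_eq0F n z :
  rho != 1 -> rho != -1 -> sfun n.+1 rho z = 0 -> cfun n.+1 rho z = 0 -> False.
Proof.
move=> r1 rN1; rewrite sfunE cfunE => s0 c0.
have e1 : 1 - rho * z = 0.
  apply: (mulfI (_ : 2%:R != 0 :> C)); first by rewrite pnatr_eq0.
  transitivity (0 - 0 : C); last by rewrite subr0 mulr0.
  by rewrite -{1}c0 -s0; ring.
have e2 : z ^+ n * (z - rho) = 0 by rewrite -s0 e1 subr0.
have rz : rho * z = 1 by apply/eqP; rewrite eq_sym -subr_eq0 e1.
have z0 : z != 0.
  by apply/eqP => z0; move/eqP: rz; rewrite z0 mulr0 eq_sym oner_eq0.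
move/eqP: e2; rewrite mulf_eq0 expf_eq0 (negPf z0) andbF subr_eq0 /= => /eqP ez.
by move/eqP: rz; rewrite ez -expr2 sqrf_eq1 (negPf r1) (negPf rN1).
Qed.

Lemma horner_p2n n z :
  (p2n n rho).[z] = z ^+ (2 * n) + (1 + rho ^+ 2) * (\sum_(1 <= k < n) z ^+ (2 * k))
  - 2 * rho * (\sum_(0 <= k < n) z ^+ (2 * k + 1)) + 1.
Proof.
rewrite /p2n !hornerE !horner_sum.
by congr (_ + _ * _ - _ * _ + _); apply: eq_bigr => k _; rewrite hornerXn.
Qed.

Lemma p2n_factor n z : (0 < n)%N ->
  (z ^+ 2 - 1) * (p2n n rho).[z] = sfun n.+1 rho z * cfun n.+1 rho z.
Proof.
case: n => // n _; rewrite sfun_mul_cfun horner_p2n.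
elim: n => [|n IH].
  by rewrite big_geq // big_nat1 muln1 [1.*2]/= mulr0 addr0 expr1; ring.
rewrite (big_nat_recr n.+1 1) //= (big_nat_recr n.+1 0) //=.
move: IH; set A := \sum_(1 <= k < n.+1) _; set B := \sum_(0 <= k < n.+1) _ => IH.
have -> : (2 * n.+2 = n.+1.*2 + 2)%N by lia.
have -> : (n.+2.*2 = n.+1.*2 + 2)%N by lia.
move: IH; have -> : (2 * n.+1 = n.+1.*2)%N by lia.
rewrite !exprD expr1; set W := z ^+ n.+1.*2 => IH.
(* The last bracket is the increment of [p_{2n}] in the induction step. *)
transitivity (W * (z - rho) ^+ 2 - (1 - rho * z) ^+ 2 +
   (z ^+ 2 - 1) * (W * z ^+ 2 + rho ^+ 2 * W - 2 * rho * W * z)); last by ring.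
by rewrite -IH; ring.
Qed.

(** For [n >= 2], the values at [1] and [-1] vanish exactly when [rho] is one of [1], [xi_n],
    respectively [-1], [-xi_n]. *)
Lemma horner_p2n_1 n : (0 < n)%N ->
  (p2n n rho).[1] = (1 - rho) * (n.+1%:R - n.-1%:R * rho).
Proof.
case: n => // n _; rewrite horner_p2n expr1n.
under eq_bigr => k _ do rewrite expr1n.
under [X in _ - _ * X]eq_bigr => k _ do rewrite expr1n.
by rewrite !sumr_const_nat subn0 subn1 /= -!natr1; ring.
Qed.

Lemma horner_p2n_N1 n : (0 < n)%N ->
  (p2n n rho).[-1] = (1 + rho) * (n.+1%:R + n.-1%:R * rho).
Proof.
have e k : (-1 : C) ^+ (2 * k) = 1 by rewrite exprM sqrrN expr1n expr1n.
case: n => // n _; rewrite horner_p2n e.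
under eq_bigr => k _ do rewrite e.
under [X in _ - _ * X]eq_bigr => k _ do rewrite exprD e mul1r expr1.
by rewrite !sumr_const_nat subn0 subn1 /= mulNrn -!natr1; ring.
Qed.

Lemma horner_p2n_0 n : (0 < n)%N -> (p2n n rho).[0] = 1.
Proof.
case: n => // n _; rewrite horner_p2n mulnS expr0n.
rewrite !big1_seq ?mulr0 ?subr0 ?add0r //.
  by move=> k _; rewrite addn1 expr0n.
by move=> k; rewrite mem_index_iota expr0n; case: k.
Qed.

Lemma horner_p2n_rho n : (0 < n)%N -> rho != 1 -> rho != -1 ->
  (p2n n rho).[rho] = 1 - rho ^+ 2.
Proof.
move=> n0 r1 rN1.
have r2 : rho ^+ 2 - 1 != 0 by rewrite subr_eq0 sqrf_eq1 negb_or r1.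
apply: (mulfI r2); rewrite p2n_factor // sfun_mul_cfun subrr; ring.
Qed.

Lemma horner_p2nV n z : (0 < n)%N -> z != 0 ->
  z ^+ n.*2 * (p2n n rho).[z^-1] = (p2n n rho).[z].
Proof.
move=> n0 z0.
(* At [1] and [-1] the factorization gives no information, but there [z^-1 = z]. *)
have [z2|z2] := eqVneq (z ^+ 2 - 1) 0.
  have {}z2 : z ^+ 2 = 1 by apply/eqP; rewrite -subr_eq0 z2.
  have -> : z^-1 = z by apply: (mulfI z0); rewrite mulfV // -expr2.
  by rewrite -muln2 mulnC exprM z2 expr1n mul1r.
apply: (mulfI z2); rewrite p2n_factor // sfun_mul_cfun.
have -> : (z ^+ 2 - 1) * (z ^+ n.*2 * (p2n n rho).[z^-1]) =
   - z ^+ 2 * z ^+ n.*2 * ((z^-1 ^+ 2 - 1) * (p2n n rho).[z^-1]).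
  by field.
rewrite p2n_factor // sfun_mul_cfun exprVn.
have zn : z ^+ n.*2 != 0 by rewrite expf_neq0.
by field; rewrite z0 zn.
Qed.

(** Together with [cfunV]: [s_{n+1}] is antipalindromic and [c_{n+1}] palindromic, so inversion
    preserves the type of a zero. *)
Lemma sfunV n z : z != 0 -> sfun n.+1 rho z^-1 = - sfun n.+1 rho z / z ^+ n.+1.
Proof.
move=> z0; rewrite !sfunE exprVn exprS.
have zn : z ^+ n != 0 by rewrite expf_neq0.
by field; rewrite z0 zn.
Qed.

Lemma cfunV n z : z != 0 -> cfun n.+1 rho z^-1 = cfun n.+1 rho z / z ^+ n.+1.
Proof.
move=> z0; rewrite !cfunE exprVn exprS.
have zn : z ^+ n != 0 by rewrite expf_neq0.
by field; rewrite z0 zn.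
Qed.

Lemma type1E n z : z != 0 -> type1 n rho z = (sfun n.+1 rho z == 0).
Proof.
move=> z0; rewrite /type1 sfunV // mulf_eq0 oppr_eq0 invr_eq0 expf_eq0 (negPf z0).
by rewrite andbF orbF andbb.
Qed.

Lemma type2E n z : z != 0 -> type2 n rho z = (cfun n.+1 rho z == 0).
Proof.
move=> z0; rewrite /type2 cfunV // mulf_eq0 invr_eq0 expf_eq0 (negPf z0).
by rewrite andbF orbF andbb.
Qed.

(* On the zeros, [s_{n+1}(z) = 0] or [c_{n+1}(z) = 0] eliminates [z^n] from
   [lamA] and [- lamA] respectively, and both become this expression. *)
Definition kms_lam z : C := (1 - rho ^+ 2) * z / ((z - rho) * (1 - rho * z)).

Lemma kms_lamV z : z != 0 -> kms_lam z^-1 = kms_lam z.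
Proof.
move=> z0; rewrite /kms_lam.
have -> : (z^-1 - rho) * (1 - rho * z^-1) = (z - rho) * (1 - rho * z) / z ^+ 2.
  by field.
(* If the denominator vanishes, both sides are [0] by the convention [0^-1 = 0]. *)
have [->|nz] := eqVneq ((z - rho) * (1 - rho * z)) 0; first by rewrite mul0r !invr0 !mulr0.
move: nz; rewrite mulf_eq0 negb_or => /andP[h1 h2].
by field; rewrite z0 h1 h2.
Qed.

Lemma lamA_type1 n z : (0 < n)%N -> z != 0 -> z != rho -> 1 - rho * z != 0 ->
  sfun n.+1 rho z = 0 ->
  lamA n rho z = kms_lam z /\ lamB n rho z = kms_lam z.
Proof.
case: n => // n _ z0 zr rz; rewrite sfunE => /eqP; rewrite subr_eq0 => /eqP e.
have {}zr : z - rho != 0 by rewrite subr_eq0.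
have zn : z ^+ n != 0 by rewrite expf_neq0.
rewrite /lamA /lamB /kms_lam -e /= !exprS.
by split; field; rewrite ?z0 ?zr ?zn.
Qed.

Lemma lamA_type2 n z : (0 < n)%N -> z != 0 -> z != rho -> 1 - rho * z != 0 ->
  cfun n.+1 rho z = 0 ->
  - lamA n rho z = kms_lam z /\ - lamB n rho z = kms_lam z.
Proof.
case: n => // n _ z0 zr rz; rewrite cfunE addrC => /eqP; rewrite addr_eq0 => /eqP e.
have {}zr : z - rho != 0 by rewrite subr_eq0.
have zn : z ^+ n != 0 by rewrite expf_neq0.
rewrite /lamA /lamB /kms_lam e /= !exprS.
by split; field; rewrite ?oppr_eq0 ?mulf_neq0 ?z0 ?zr ?zn.
Qed.

End Zeros.

(** * The factorization at the level of polynomials *)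

(* Both [s_{n+1}] ([e = 1]) and [c_{n+1}] ([e = -1]) as polynomials. *)
Definition scpoly (R : nzRingType) (rho e : R) (n : nat) : {poly R} :=
  ('X - rho%:P) * 'X^n + e *: (rho *: 'X - 1).

Lemma horner_scpoly (R : comNzRingType) (rho e : R) (n : nat) (z : R) :
  (scpoly rho e n).[z] = z ^+ n * (z - rho) - e * (1 - rho * z).
Proof. by rewrite /scpoly !hornerE; ring. Qed.

Lemma size_scpoly_low (R : nzRingType) (rho e : R) (n : nat) : (2 <= n)%N ->
  (size (e *: (rho *: 'X - 1) : {poly R})%R < size (('X - rho%:P) * 'X^n)%R)%N.
Proof.
move=> n2; rewrite size_mulXn ?polyXsubC_eq0 // size_XsubC.
apply: leq_ltn_trans (size_scale_leq _ _) _.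
apply: leq_ltn_trans (size_polyD _ _) _.
rewrite size_polyN size_poly1 gtn_max addn2 /= andbT.
by apply: leq_ltn_trans (size_scale_leq _ _) _; rewrite size_polyX !ltnS ltnW.
Qed.

Lemma size_scpoly (R : nzRingType) (rho e : R) (n : nat) : (2 <= n)%N ->
  size (scpoly rho e n) = n.+2.
Proof.
move=> n2; rewrite /scpoly size_polyDl ?size_scpoly_low //.
by rewrite size_mulXn ?polyXsubC_eq0 // size_XsubC addn2.
Qed.

Lemma monic_scpoly (R : nzRingType) (rho e : R) (n : nat) : (2 <= n)%N ->
  scpoly rho e n \is monic.
Proof.
move=> n2; rewrite monicE /scpoly lead_coefDl ?size_scpoly_low //.
by rewrite -monicE monicMr ?monicXn ?monicXsubC.
Qed.

Lemma scpoly_roots (C : numClosedFieldType) (rho e : C) (n : nat) : (2 <= n)%N ->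
  exists2 rs : seq C, size rs = n.+1 &
    scpoly rho e n = \prod_(z <- rs) ('X - z%:P).
Proof.
move=> n2; have [rs ers] := closed_field_poly_normal (scpoly rho e n).
move: ers; rewrite (monicP (monic_scpoly rho e n2)) scale1r => ers.
exists rs => //; apply: succn_inj.
by rewrite -(size_scpoly rho e n2) ers size_prod_XsubC.
Qed.

(** Lifting [p2n_factor] to polynomials allows zeros to be compared with multiplicity. *)
Lemma p2n_scpoly (C : numClosedFieldType) (rho : C) (n : nat) : (0 < n)%N ->
  p2n n rho * (('X - 1%:P) * ('X - (-1)%:P)) = scpoly rho 1 n * scpoly rho (-1) n.
Proof.
move=> n0; apply: (@eq_poly_of_horner _ _ _ 1); first by rewrite oner_neq0.
move=> z _; rewrite !hornerM !horner_scpoly mul1r mulN1r opprK -sfunE -cfunE.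
by rewrite -p2n_factor // !hornerXsubC; ring.
Qed.

Lemma horner_char_poly (R : comNzRingType) (n : nat) (A : 'M[R]_n) (x : R) :
  (char_poly A).[x] = \det (x%:M - A).
Proof.
rewrite /char_poly -horner_evalE -det_map_mx; congr (\det _).
apply/matrixP => i j; rewrite !mxE /= horner_evalE.
by rewrite hornerD hornerN hornerC hornerMn hornerX.
Qed.

(** * The zeros, their types, and the characteristic polynomial *)

Section Spectrum.
Variables (C : numClosedFieldType) (n : nat) (rho : C) (zs : seq C).
Hypotheses (n2 : (2 <= n)%N) (rN1 : rho != -1) (r1 : rho != 1)
  (pzs : p2n n rho = \prod_(z <- zs) ('X - z%:P)).

Let n0 : (0 < n)%N. Proof. exact: ltnW. Qed.

Let mem_zs z : (z \in zs) = ((p2n n rho).[z] == 0).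
Proof. by rewrite pzs -root_prod_XsubC rootE. Qed.

Lemma zero_neq0 z : z \in zs -> z != 0.
Proof.
by apply: contraTneq => ->; rewrite mem_zs horner_p2n_0 // oner_eq0.
Qed.

Lemma zeroV z : z \in zs -> z^-1 \in zs.
Proof.
move=> zz; have z0 := zero_neq0 zz.
move: zz; rewrite !mem_zs -(horner_p2nV rho n0 z0) mulf_eq0 expf_eq0 (negPf z0).
by rewrite andbF.
Qed.

Lemma zero_neq_rho z : z \in zs -> z != rho.
Proof.
apply: contraTneq => ->; rewrite mem_zs horner_p2n_rho // subr_eq0 eq_sym.
by rewrite sqrf_eq1 negb_or r1.
Qed.

Lemma zero_rho_neq1 z : z \in zs -> 1 - rho * z != 0.
Proof.
move=> zz; have z0 := zero_neq0 zz; have := zero_neq_rho (zeroV zz).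
apply: contra; rewrite subr_eq0 => /eqP e.
by apply/eqP/(mulIf z0); rewrite mulVf.
Qed.

Lemma size_zs : size zs = n.*2.
Proof.
have := congr1 (fun p : {poly C} => size p) (p2n_scpoly rho n0).
rewrite pzs !size_monicM ?monic_scpoly ?size_scpoly ?monicMl ?monicXsubC //;
  rewrite ?monic_neq0 ?monic_scpoly ?monic_prod_XsubC ?monicXsubC //.
  by rewrite !size_XsubC size_prod_XsubC; lia.
by rewrite monicMl monicXsubC.
Qed.

(** Multiplicities matter here, so palindromicity is used on whole products: [w^{2n} p_{2n}(1/w)] is
    the product of the [1 - w z = -z (w - 1/z)], and comparing leading coefficients shows that the
    constant [k] is [1]. *)
Lemma zeros_perm_inv : perm_eq zs (map GRing.inv zs).
Proof.
apply: prod_XsubC_eq; rewrite -pzs big_map.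
pose k : C := \prod_(z <- zs) (- z).
have pk : p2n n rho = k *: \prod_(z <- zs) ('X - z^-1%:P).
  apply: (@eq_poly_of_horner _ _ _ 'X); first by rewrite polyX_eq0.
  move=> w; rewrite hornerX => w0; rewrite -horner_p2nV // pzs hornerZ !horner_prod.
  (* The power of [w] is spread out as one factor [w] per zero. *)
  rewrite -size_zs -(count_predT zs) -iter_mulr_1 -big_const_seq -big_split -big_split /=.
  apply: eq_big_seq => z zz.
  rewrite !hornerE; have z0 := zero_neq0 zz.
  by field; rewrite w0 z0.
have k1 : k = 1.
  have := congr1 lead_coef pk.
  by rewrite pzs lead_coefZ !(monicP (monic_prod_XsubC _ _ _)) mulr1.
by rewrite pk k1 scale1r.
Qed.

(** Adding [1] and [-1] to the zeros gives the roots of [s_{n+1}] and [c_{n+1}] together. All [n+1]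
    roots of [s_{n+1}] have type 1 and none of [c_{n+1}] has. It remains to subtract [1], always a
    root of [s_{n+1}], and [-1], a root exactly for odd [n]. *)
Lemma count_type1 : count (type1 n rho) zs = (2 * n./2)%N.
Proof.
have [rs srs ers] := scpoly_roots rho 1 n2.
have [rc src erc] := scpoly_roots rho (-1) n2.
have pe : perm_eq (zs ++ [:: 1; -1]) (rs ++ rc).
  apply: prod_XsubC_eq; rewrite !big_cat /= -pzs -ers -erc big_cons big_seq1.
  by rewrite p2n_scpoly.
have rs0 z : z \in rs -> sfun n.+1 rho z = 0.
  by rewrite -root_prod_XsubC -ers rootE horner_scpoly mul1r sfunE => /eqP.
have rc0 z : z \in rc -> cfun n.+1 rho z = 0.
  by rewrite -root_prod_XsubC -erc rootE horner_scpoly mulN1r opprK cfunE => /eqP.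
have nz z : z \in rs ++ rc -> z != 0.
  rewrite -(perm_mem pe) mem_cat => /orP[/zero_neq0 //|].
  by rewrite !inE => /orP[]/eqP ->; rewrite ?oppr_eq0 oner_neq0.
have := permP pe (type1 n rho); rewrite !count_cat.
have -> : count (type1 n rho) rs = n.+1.
  rewrite -srs; apply/eqP; rewrite -all_count; apply/allP => z zr.
  by rewrite type1E ?rs0 // nz // mem_cat zr.
have -> : count (type1 n rho) rc = 0%N.
  apply/eqP; rewrite eqn0Ngt -has_count; apply/hasPn => z zr.
  have z0 : z != 0 by rewrite nz // mem_cat zr orbT.
  rewrite type1E //; apply/negP => /eqP s0.
  exact: sfun_cfun_eq0F r1 rN1 s0 (rc0 z zr).
rewrite /= !type1E ?oppr_eq0 ?oner_neq0 // !sfunE expr1n.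
have -> : (1 * (1 - rho) - (1 - rho * 1) == 0) by rewrite mul1r mulr1 subrr.
have -> : ((-1) ^+ n * (-1 - rho) - (1 - rho * -1) == 0) = odd n.
  rewrite -signr_odd; case: (odd n); rewrite ?expr0 ?expr1.
    by apply/eqP; ring.
  apply/negbTE; rewrite (_ : _ - _ = - (2 * (1 + rho))); last by ring.
  by rewrite oppr_eq0 mulf_neq0 ?pnatr_eq0 // addrC addr_eq0.
have := odd_double_half n; lia.
Qed.

Lemma zero_type z : z \in zs -> type2 n rho z = ~~ type1 n rho z.
Proof.
move=> zz; have z0 := zero_neq0 zz; rewrite type1E // type2E //.
have /eqP : sfun n.+1 rho z * cfun n.+1 rho z = 0.
  by rewrite -p2n_factor //; move: zz; rewrite mem_zs => /eqP ->; rewrite mulr0.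
rewrite mulf_eq0; have [s0 _|_ /= ->] := eqVneq (sfun n.+1 rho z) 0; last by [].
by apply/negP => /eqP; exact: sfun_cfun_eq0F r1 rN1 s0.
Qed.

Lemma count_type2 : count (type2 n rho) zs = (2 * uphalf n)%N.
Proof.
have := count_predC (type1 n rho) zs.
rewrite -(eq_in_count (a1 := type2 n rho) zero_type) count_type1 size_zs uphalf_half.
by move: (count _ _) (odd_double_half n) => c; lia.
Qed.

Lemma zero_lam_type1 z : z \in zs -> type1 n rho z ->
  lamA n rho z = kms_lam rho z /\ lamB n rho z = kms_lam rho z.
Proof.
move=> zz; have z0 := zero_neq0 zz; rewrite type1E // => /eqP s0.
by apply: lamA_type1 => //; [exact: zero_neq_rho|exact: zero_rho_neq1].
Qed.

Lemma zero_lam_type2 z : z \in zs -> type2 n rho z ->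
  - lamA n rho z = kms_lam rho z /\ - lamB n rho z = kms_lam rho z.
Proof.
move=> zz; have z0 := zero_neq0 zz; rewrite type2E // => /eqP s0.
by apply: lamA_type2 => //; [exact: zero_neq_rho|exact: zero_rho_neq1].
Qed.

Lemma kms_rho0 : kms n (0 : C) = 1%:M.
Proof.
apply/matrixP => i j; rewrite !mxE expr0n -val_eqE /=.
by congr (_%:R); congr nat_of_bool; lia.
Qed.

(* For [x = kms_lam w] each factor [x - kms_lam z] is, up to a constant,
   [(w - z) (w - 1/z)], so the product over one zero per inverse pair is [p_{2n}(w)]. *)
Lemma char_poly_kms (t : seq C) : perm_eq zs (t ++ map GRing.inv t) ->
  char_poly (kms n rho) = \prod_(z <- t) ('X - (kms_lam rho z)%:P).
Proof.
move=> pt.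
have tzs z : z \in t -> z \in zs by move=> zt; rewrite (perm_mem pt) mem_cat zt.
have st : size t = n.
  by have := perm_size pt; rewrite size_zs size_cat size_map addnn => /double_inj.
(* For [rho = 0] the equation for [w] loses its quadratic term; there [K_n = I] and every [kms_lam]
   is [1]. *)
have [r0|r0] := eqVneq rho 0.
  rewrite r0 kms_rho0 /char_poly /char_poly_mx map_mx1 -raddfB det_scalar -{1}st.
  rewrite -(count_predT t) -iter_mulr_1 -big_const_seq; apply: eq_big_seq => z /tzs/zero_neq0 z0.
  by rewrite /kms_lam expr0n !subr0 mul0r subr0 mul1r mulr1 divff.
have r2 : 1 - rho ^+ 2 != 0 by rewrite subr_eq0 eq_sym sqrf_eq1 negb_or r1.
have lin0 (a : C) : a *: 'X - (1 - rho ^+ 2)%:P != 0.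
  apply: contraNneq r2 => /(congr1 (horner^~ 0)).
  by rewrite hornerD hornerN hornerZ hornerX !hornerC mulr0 add0r => /eqP; rewrite oppr_eq0.
(* The excluded [x] are [0] and those for which [w = 1] or [w = -1] solves the equation [q]. *)
pose r : {poly C} := 'X * ((1 - rho) ^+ 2 *: 'X - (1 - rho ^+ 2)%:P)
   * ((1 + rho) ^+ 2 *: 'X - (1 - rho ^+ 2)%:P).
apply: (@eq_poly_of_horner _ _ _ r) => [|x].
  by rewrite /r !mulf_neq0 ?polyX_eq0 // lin0.
rewrite /r !hornerM !hornerD !hornerN !hornerZ !hornerC hornerX !mulf_eq0 !negb_or.
move=> /andP[/andP[x0 x1] xN1].
(* A root of [q] is a [w] as required by [det_kms_closed_form]; it exists since the leading
   coefficient [x rho] is nonzero. *)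
pose q : {poly C} := (x * rho) *: ('X^2 + 1) - (x * (1 + rho ^+ 2) - (1 - rho ^+ 2)) *: 'X.
have [w /rootP] : exists w, root q w.
  apply/closed_rootP.
  have : q`_2 != 0 by rewrite /q !coefE /= mulr0 subr0 addr0 mulr1 mulf_neq0.
  by apply: contraNneq => sq; rewrite nth_default // sq.
rewrite /q !hornerE => /eqP; rewrite subr_eq0 => /eqP xw.
have xr0 : x * rho != 0 by rewrite mulf_neq0.
have w0 : w != 0.
  by apply/eqP => w0; move/eqP: xw; rewrite w0 mulr0 expr0n add0r mulr1 (negPf xr0).
have w2 : w ^+ 2 - 1 != 0.
  rewrite subr_eq0 sqrf_eq1 negb_or; apply/andP; split.
    apply: contra x1 => /eqP e; rewrite e in xw; move/eqP: xw.
    by rewrite eq_sym -subr_eq0; congr (_ == _); ring.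
  apply: contra xN1 => /eqP e; rewrite e in xw; move/eqP: xw.
  by rewrite -subr_eq0; congr (_ == _); ring.
have prodt y : (p2n n rho).[y] = \prod_(z <- t) ((y - z) * (y - z^-1)).
  rewrite pzs (perm_big _ pt) big_cat big_map hornerM !horner_prod -big_split /=.
  by apply: eq_bigr => z _; rewrite !hornerXsubC.
have wn : w ^+ n != 0 by rewrite expf_neq0.
rewrite horner_char_poly.
apply: (mulfI (mulf_neq0 wn (mulf_neq0 w2 r2))).
rewrite (det_kms_closed_form n xw) -sfun_mul_cfun -p2n_factor //.
rewrite horner_prod.
(* Each factor is [x - kms_lam z = (x rho / w) (w - z) (w - 1/z) / ((rho - z) (rho - 1/z))], so the
   denominators multiply to [p_{2n}(rho) = 1 - rho^2]. *)
have -> : \prod_(z <- t) ('X - (kms_lam rho z)%:P).[x] =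
  (x * rho / w) ^+ n * (p2n n rho).[w] / (p2n n rho).[rho].
  rewrite !prodt -{1}st -(count_predT t) -iter_mulr_1 -big_const_seq.
  rewrite -prodfV -!big_split /=; apply: eq_big_seq => z zt.
  have zz := tzs _ zt; have z0 := zero_neq0 zz.
  have := zero_neq_rho zz; have := zero_rho_neq1 zz.
  rewrite -(subr_eq0 z) hornerXsubC => h1 h2.
  have h3 : rho - z != 0 by rewrite -opprB oppr_eq0.
  have h4 : rho * z - 1 != 0 by rewrite -opprB oppr_eq0.
  have -> : kms_lam rho z = x * (w * (1 + rho ^+ 2) - rho * (w ^+ 2 + 1)) / w * z
      / ((z - rho) * (1 - rho * z)).
    rewrite /kms_lam; congr (_ * _ / _); apply: (mulIf w0); rewrite divfK //.
    transitivity (x * w * (1 + rho ^+ 2) - (x * (1 + rho ^+ 2) - (1 - rho ^+ 2)) * w).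
      by ring.
    by rewrite -xw; ring.
  by field; rewrite ?w0 ?z0 ?h1 ?h2 ?h3 ?h4.
rewrite horner_p2n_rho // expr_div_n.
by field; rewrite r2 wn.
Qed.

Hypotheses (rNxi : rho != - xi C n) (rxi : rho != xi C n).

Lemma zero_neq1 z : z \in zs -> z != 1.
Proof.
apply: contraTneq => ->; rewrite mem_zs horner_p2n_1 // mulf_neq0 //.
  by rewrite subr_eq0 eq_sym.
have m0 : n.-1%:R != 0 :> C by rewrite pnatr_eq0 -lt0n ltn_predRL.
apply: contra rxi; rewrite subr_eq0 /xi => /eqP ->.
by rewrite mulrAC divff // mul1r.
Qed.

Lemma zero_neqN1 z : z \in zs -> z != -1.
Proof.
apply: contraTneq => ->; rewrite mem_zs horner_p2n_N1 // mulf_neq0 //.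
  by rewrite addrC addr_eq0.
have m0 : n.-1%:R != 0 :> C by rewrite pnatr_eq0 -lt0n ltn_predRL.
apply: contra rNxi; rewrite addr_eq0 /xi => /eqP ->.
by rewrite mulNr mulrAC divff // mul1r opprK.
Qed.

(** The only nonzero fixed points of inversion are [1] and [-1], and neither is a zero. *)
Lemma zeros_split : exists t : seq C, perm_eq zs (t ++ map GRing.inv t).
Proof.
apply: perm_involutive_split zeros_perm_inv; first exact: invrK.
move=> z zz; have z0 := zero_neq0 zz.
apply: contraTneq (zz) => e; apply/negP => _.
have : z ^+ 2 == 1 by rewrite expr2 -{1}e mulVf.
by rewrite sqrf_eq1 (negPf (zero_neq1 zz)) (negPf (zero_neqN1 zz)).
Qed.

End Spectrum.

(** * Assembly of the classification and the eigenvalue counts *)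

Theorem theorem3p7 (C : numClosedFieldType) (n : nat) (rho : C) (zs : seq C) :
  (2 <= n)%N ->
  rho != - xi C n -> rho != -1 -> rho != 1 -> rho != xi C n ->
  (* zs = z_0, ..., z_{2n-1}: the zeros of p_{2n}(rho, .) with multiplicity *)
  p2n n rho = \prod_(z <- zs) ('X - z%:P) ->
  [/\ forall z, z \in zs -> z != 1 /\ z != -1,
      forall z, z \in zs ->
        (type1 n rho z \/ type2 n rho z) /\ ~ (type1 n rho z /\ type2 n rho z),
      forall z, z \in zs -> type1 n rho z ->
        lamA n rho z = lamB n rho z /\ eigenvalue (kms n rho) (lamA n rho z),
      forall z, z \in zs -> type2 n rho z ->
        - lamA n rho z = - lamB n rho z /\ eigenvalue (kms n rho) (- lamA n rho z)
    & [/\ count (type1 n rho) zs = (2 * n./2)%N,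
          count (type2 n rho) zs = (2 * uphalf n)%N
        & exists P1 P2 : {poly C},
        [/\ P1 \is monic, P2 \is monic,
            char_poly (kms n rho) = P1 * P2,
            P1 ^+ 2 = \prod_(z <- zs | type1 n rho z) ('X - (lamA n rho z)%:P)
          & P2 ^+ 2 = \prod_(z <- zs | type2 n rho z) ('X - (- lamA n rho z)%:P)]]].
Proof.
move=> n2 rNxi rN1 r1 rxi pzs.
have [t pt] := zeros_split n2 rN1 r1 pzs rNxi rxi.
have cp := char_poly_kms n2 rN1 r1 pzs pt.
have nz z (zz : z \in zs) := zero_neq0 n2 pzs zz.
have tzs z : z \in t -> z \in zs by move=> zt; rewrite (perm_mem pt) mem_cat zt.
have tyV z : (type1 n rho z^-1 = type1 n rho z) * (type2 n rho z^-1 = type2 n rho z).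
  by rewrite /type1 /type2 !invrK andbC [_ && (cfun _ _ _ == 0)]andbC.
have eig z : z \in zs -> eigenvalue (kms n rho) (kms_lam rho z).
  rewrite (perm_mem pt) mem_cat eigenvalue_root_char cp => zt.
  suff [y yt ->] : exists2 y, y \in t & kms_lam rho z = kms_lam rho y.
    by rewrite -(big_map (kms_lam rho) xpredT (fun x => 'X - x%:P)) root_prod_XsubC map_f.
  case/orP: zt => [zt|/mapP[y yt ->]]; first by exists z.
  by exists y => //; rewrite kms_lamV // nz // tzs.
(* Each pair [z], [1/z] contributes the same factor twice, because [kms_lam] is invariant under
   inversion. *)
have sq (T : pred C) : (forall z, z \in t -> T z^-1 = T z) ->
    (\prod_(z <- t | T z) ('X - (kms_lam rho z)%:P)) ^+ 2 =
    \prod_(z <- zs | T z) ('X - (kms_lam rho z)%:P).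
  move=> TV; rewrite (perm_big _ pt) big_cat big_map expr2; congr (_ * _).
  rewrite big_seq_cond [RHS]big_seq_cond; apply: eq_big => z.
    by case: (boolP (z \in t)) => // /TV ->.
  by case/andP=> /tzs/nz z0 _; rewrite kms_lamV.
split.
- by move=> z zz; split; [exact: (zero_neq1 n2 r1 pzs rxi)|exact: (zero_neqN1 n2 rN1 pzs rNxi)].
- move=> z zz; rewrite (zero_type n2 rN1 r1 pzs zz).
  by case: (type1 n rho z); split; [left| case | right | case].
- move=> z zz ty; have [-> ->] := zero_lam_type1 n2 rN1 r1 pzs zz ty.
  by split=> //; exact: eig.
- move=> z zz ty; have [-> ->] := zero_lam_type2 n2 rN1 r1 pzs zz ty.
  by split=> //; exact: eig.
split; [exact: count_type1|exact: count_type2|].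
(* One zero per inverse pair: by the counts above, the squares have degrees [2 * n./2] and
   [2 * uphalf n], so these factors carry the stated numbers of eigenvalues with multiplicity. *)
exists (\prod_(z <- t | type1 n rho z) ('X - (kms_lam rho z)%:P)),
       (\prod_(z <- t | type2 n rho z) ('X - (kms_lam rho z)%:P)).
split.
- exact: monic_prod_XsubC.
- exact: monic_prod_XsubC.
- rewrite cp (bigID (type1 n rho)) /=; congr (_ * _).
  rewrite big_seq_cond [RHS]big_seq_cond; apply: eq_bigl => z.
  by case: (boolP (z \in t)) => //= /tzs zz; rewrite (zero_type n2 rN1 r1 pzs zz).
- rewrite sq => [|z _]; last by rewrite tyV.
  rewrite big_seq_cond [RHS]big_seq_cond; apply: eq_bigr => z /andP[zz ty].
  by have [-> _] := zero_lam_type1 n2 rN1 r1 pzs zz ty.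
- rewrite sq => [|z _]; last by rewrite tyV.
  rewrite big_seq_cond [RHS]big_seq_cond; apply: eq_bigr => z /andP[zz ty].
  by have [-> _] := zero_lam_type2 n2 rN1 r1 pzs zz ty.
Qed.
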